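(* Let $N$ be the place-transition net with places $p_1,\dots,p_8$ and transitions $t_1,\dots,t_6$, whose arcs (all of multiplicity $1$ unless stated otherwise) are: $t_1$: input $p_1$; output $p_5$ with multiplicity $2$. $t_2$: inputs $p_4, p_5$; output $p_6$. $t_3$: inputs $p_4, p_5, p_8$; outputs $p_7, p_8$. $t_4$: input $p_6$ with multiplicity $2$; outputs $p_2$ and $p_4$ with multiplicity $2$. $t_5$: inputs $p_5, p_6$; outputs $p_3, p_4$. $t_6$: inputs $p_5, p_7$; outputs $p_3, p_4$. Let $x \geq 1$ be an integer and consider the initial marking $\{p_1, x\cdot p_4, p_8\}$ (one token in $p_1$, $x$ tokens in $p_4$, one token in $p_8$, no other tokens). Run $N$ as a strong Sleptsov net. Then every run of the net from this initial marking terminates (reaches a marking in which no transition is firable), and the terminal marking is $\{p_2, x\cdot p_4, p_8\}$ if $x>1$, and $\{p_3, x\cdot p_4, p_8\}$ if $x=1$. Thus, if a register with nonnegative integer value $v$ is stored in place $p_4$ as the marking $x=v+1$, the net, started by a token in $p_1$, puts a token into $p_3$ exactly when $v=0$ and into $p_2$ exactly when $v>0$, leaving the register unchanged.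
   Context: A place-transition net is $N=(P,T,A,\mu_0)$ with finite place set $P$, finite transition set $T$, arc multiplicities $A: P\times T \cup T\times P \to \mathbb{Z}_{\geq 0}$ (writing $a(p,t)$, $a(t,p)$), and markings $\mu: P\to\mathbb{Z}_{\geq 0}$, $\mu_0$ initial. The firability multiplicity of transition $t$ in marking $\mu$ is $c(t)=\min_{p: a(p,t)>0} \lfloor \mu(p)/a(p,t)\rfloor$; $t$ is firable if $c(t)>0$. In a strong Sleptsov net, at each step one firable transition $t$ whose $c(t)$ is maximal among all transitions is chosen (nondeterministically if several have the same maximal value) and fires $c(t)$ times at once: $\mu'(p)=\mu(p)-c(t)\,a(p,t)+c(t)\,a(t,p)$ for all $p\in P$. The net of the claim is the paper's zero-check net given in a figure; its arcs are as reconstructed from the firing sequences described in the paper's proof. *)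

(* Defs.v *)
From HB Require Import structures.
From mathcomp Require Import all_boot.

Set Implicit Arguments.
Unset Strict Implicit.
Unset Printing Implicit Defensive.

Record ptnet (P T : finType) : Type := PTNet {
  pre : P -> T -> nat;
  post : T -> P -> nat;
  init : {ffun P -> nat}
}.

Section StrongSleptsov.

Variables (P T : finType) (N : ptnet P T).
Implicit Types (mu : {ffun P -> nat}) (t : T).

(* The minimum of mu(p) %/ a(p,t) over the input places p of t. The seed of   *)
(* the iterated minn is itself one of the values, so it does not affect the   *)
(* result. The minimum is undefined when t has no input place; such a t gets  *)
(* the junk value 0.                                                          *)
Definition fire_mult mu t : nat :=
  if [pick p | 0 < pre N p t] is Some p0 then
    \big[minn/mu p0 %/ pre N p0 t]_(p | 0 < pre N p t) (mu p %/ pre N p t)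
  else 0.

Definition firable mu t : bool := 0 < fire_mult mu t.

(* The truncated subtraction is exact: fire_mult mu t * pre N p t <= mu p.    *)
Definition fire mu t : {ffun P -> nat} :=
  [ffun p => mu p - fire_mult mu t * pre N p t + fire_mult mu t * post N t p].

Definition sstep : rel {ffun P -> nat} := fun mu mu' =>
  [exists t, [&& firable mu t,
                 [forall u, fire_mult mu u <= fire_mult mu t]
               & mu' == fire mu t]].

Definition terminal mu : bool := [forall t, ~~ firable mu t].

(* A finite run is given by the markings that follow the initial one. *)
Definition finite_run (s : seq {ffun P -> nat}) : bool := path sstep (init N) s.

Definition final_marking (s : seq {ffun P -> nat}) : {ffun P -> nat} :=
  last (init N) s.

Definition maximal_run (s : seq {ffun P -> nat}) : Prop :=
  finite_run s /\ forall mu, ~~ sstep (final_marking s) mu.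

Definition infinite_run (r : nat -> {ffun P -> nat}) : Prop :=
  r 0 = init N /\ forall n, sstep (r n) (r n.+1).

(* There is no infinite run, and every run that cannot be continued has       *)
(* reached a marking in which no transition is firable.                       *)
Definition every_run_terminates : Prop :=
  (~ exists r, infinite_run r) /\
  (forall s, maximal_run s -> terminal (final_marking s)).

End StrongSleptsov.

Inductive place := p1 | p2 | p3 | p4 | p5 | p6 | p7 | p8.

Definition place_ord (p : place) : 'I_8 :=
  match p with
  | p1 => @Ordinal 8 0 isT | p2 => @Ordinal 8 1 isT
  | p3 => @Ordinal 8 2 isT | p4 => @Ordinal 8 3 isT
  | p5 => @Ordinal 8 4 isT | p6 => @Ordinal 8 5 isT
  | p7 => @Ordinal 8 6 isT | p8 => @Ordinal 8 7 isT
  end.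

Definition ord_place (i : 'I_8) : place :=
  nth p1 [:: p1; p2; p3; p4; p5; p6; p7; p8] i.

Lemma place_ordK : cancel place_ord ord_place. Proof. by case. Qed.

HB.instance Definition _ := Finite.copy place (can_type place_ordK).

Inductive trans := t1 | t2 | t3 | t4 | t5 | t6.

Definition trans_ord (t : trans) : 'I_6 :=
  match t with
  | t1 => @Ordinal 6 0 isT | t2 => @Ordinal 6 1 isT
  | t3 => @Ordinal 6 2 isT | t4 => @Ordinal 6 3 isT
  | t5 => @Ordinal 6 4 isT | t6 => @Ordinal 6 5 isT
  end.

Definition ord_trans (i : 'I_6) : trans :=
  nth t1 [:: t1; t2; t3; t4; t5; t6] i.

Lemma trans_ordK : cancel trans_ord ord_trans. Proof. by case. Qed.

HB.instance Definition _ := Finite.copy trans (can_type trans_ordK).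

Definition zc_pre (p : place) (t : trans) : nat :=
  match t, p with
  | t1, p1 => 1
  | t2, (p4 | p5) => 1
  | t3, (p4 | p5 | p8) => 1
  | t4, p6 => 2
  | t5, (p5 | p6) => 1
  | t6, (p5 | p7) => 1
  | _, _ => 0
  end.

Definition zc_post (t : trans) (p : place) : nat :=
  match t, p with
  | t1, p5 => 2
  | t2, p6 => 1
  | t3, (p7 | p8) => 1
  | t4, p2 => 1
  | t4, p4 => 2
  | t5, (p3 | p4) => 1
  | t6, (p3 | p4) => 1
  | _, _ => 0
  end.

(* The marking {q, x.p4, p8}, for q other than p4 and p8. *)
Definition zc_marking (q : place) (x : nat) : {ffun place -> nat} :=
  [ffun p => if p == q then 1
             else match p with p4 => x | p8 => 1 | _ => 0 end].

Definition zero_check (x : nat) : ptnet place trans :=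
  PTNet zc_pre zc_post (zc_marking p1 x).

(* Main.v *)
Require Import Defs.
From mathcomp Require Import all_boot all_order.
From mathcomp Require Import zify.

Set Implicit Arguments.
Unset Strict Implicit.
Unset Printing Implicit Defensive.

Import Order.TTheory.

(** The token of [p1] becomes two tokens in [p5].  If [x > 1], then [t2] has
    multiplicity 2 while [t3] is held to 1 by the single token of [p8], so [t2]
    takes both tokens at once, and [t4] restores [p4] and marks [p2].  If
    [x = 1], then [t2] and [t3] tie with multiplicity 1; either one leaves one
    token in [p5] and one in [p6] or [p7], and then [t5] or [t6], respectively,
    restores [p4] and marks [p3]. *)

Section InevitableOutcome.

Variables (M : Type) (e : rel M).
Implicit Types (x y z : M) (s : seq M) (r : nat -> M).

Definition stuck x : Prop := forall y, ~~ e x y.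

(* Every maximal [e]-path from [x] is finite and ends at [z]. *)
Inductive inevitable z : M -> Prop :=
  | InevitableStuck : stuck z -> inevitable z z
  | InevitableStep x y : e x y ->
      (forall y', e x y' -> inevitable z y') -> inevitable z x.

Lemma inevitable_no_infinite_path z x r :
  inevitable z x -> r 0 = x -> ~ forall n, e (r n) (r n.+1).
Proof.
move=> out; elim: out r => [z_stuck|{}x y _ _ IH] r r0 r_path.
  by move: (z_stuck (r 1)); rewrite -r0 r_path.
by apply: (IH (r 1) _ (fun n => r n.+1)) => //; rewrite -r0.
Qed.

Lemma inevitable_last z x s :
  inevitable z x -> path e x s -> stuck (last x s) -> last x s = z.
Proof.
move=> out; elim: out s => [z_stuck|{}x y exy _ IH] [|y' s] //=.
- by rewrite (negbTE (z_stuck y')).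
- by move=> _ /(_ y); rewrite exy.
- by case/andP=> /IH; apply.
Qed.

End InevitableOutcome.

Lemma inevitable_successors (M : eqType) (e : rel M) (z x y : M) (s : seq M) :
  e x =i y :: s -> {in y :: s, forall y', inevitable e z y'} -> inevitable e z x.
Proof.
move=> ex out; apply: (@InevitableStep _ _ _ _ y) => [|y' xy'].
  by have := ex y; rewrite mem_head.
by apply: out; rewrite -ex.
Qed.

Lemma inevitable_unique (M : eqType) (e : rel M) (z x y : M) :
  e x =i [:: y] -> inevitable e z y -> inevitable e z x.
Proof.
by move=> ex out; apply: inevitable_successors ex _ => y'; rewrite inE => /eqP->.
Qed.

Section StrongSleptsovNets.

Variables (P T : finType) (N : ptnet P T).
Implicit Types (mu nu : {ffun P -> nat}) (t u : T).

Lemma leq_fire_mult mu t q k : 0 < pre N q t ->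
  (k <= fire_mult N mu t) = [forall p, k * pre N p t <= mu p].
Proof.
rewrite /fire_mult => q_in; case: pickP => [p0 p0_in|/(_ q)]; last by rewrite q_in.
rewrite -minEnat.
apply/(@bigmin_geP _ nat)/forallP => [[_ le_k] p|le_k].
  have [->|p_in] := posnP (pre N p t); first by rewrite muln0.
  by rewrite -leq_divRL //; apply: le_k.
by split=> [|p p_in]; rewrite leEnat leq_divRL.
Qed.

Lemma fire_mult_eq mu t q m : 0 < pre N q t ->
  (forall k, (k <= m) = [forall p, k * pre N p t <= mu p]) ->
  fire_mult N mu t = m.
Proof.
move=> q_in leq_m; apply/eqP; rewrite eqn_leq (leq_fire_mult _ _ q_in) -leq_m.
by rewrite leqnn andbT leq_m -(leq_fire_mult _ _ q_in).
Qed.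

Lemma sstepP mu nu :
  reflect (exists t, [/\ firable N mu t,
                         forall u, fire_mult N mu u <= fire_mult N mu t
                       & nu = fire N mu t])
          (sstep N mu nu).
Proof.
apply: (iffP existsP) => -[t].
  by case/and3P=> ft /forallP max_t /eqP ->; exists t.
by case=> ft max_t ->; exists t; rewrite ft eqxx andbT; apply/forallP.
Qed.

Lemma terminalP mu : reflect (stuck (sstep N) mu) (terminal N mu).
Proof.
apply: (iffP forallP) => [no_firable nu|mu_stuck t].
  by apply/sstepP => -[t [ft _ _]]; move: (no_firable t); rewrite ft.
apply/negP => ft.
have [u _ max_u] := @arg_maxnP _ t xpredT (fire_mult N mu) isT.
case/sstepP: (mu_stuck (fire N mu u)); exists u.
by split=> // [|v]; [apply: leq_trans (max_u t _) | apply: max_u].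
Qed.

Lemma inevitable_final_marking nu : inevitable (sstep N) nu (init N) ->
  every_run_terminates N /\ forall s, maximal_run N s -> final_marking N s = nu.
Proof.
move=> out; split=> [|s []]; last exact: inevitable_last.
split=> [[r [r0 r_path]]|s [_ /terminalP] //].
exact: inevitable_no_infinite_path out r0 r_path.
Qed.

Lemma sstep_maximal mu k t ts : 0 < k ->
  (forall u, fire_mult N mu u <= k ?= iff (u \in t :: ts)) ->
  sstep N mu =i [seq fire N mu u | u <- t :: ts].
Proof.
move=> k_gt0 le_k nu.
have multE u : u \in t :: ts -> fire_mult N mu u = k.
  by move=> u_max; apply/eqP; rewrite (le_k u).2.
apply/sstepP/mapP => [[u [_ max_u ->]]|[u u_max ->]]; exists u => //.
  by rewrite -(le_k u).2 eqn_leq (le_k u).1 -(multE t) ?mem_head ?max_u.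
by rewrite /firable multE //; split=> // v; apply: (le_k v).1.
Qed.

Lemma sstep_unique mu k t nu : 0 < k ->
  (forall u, fire_mult N mu u <= k ?= iff (u == t)) ->
  (forall p, mu p - k * pre N p t + k * post N t p = nu p) ->
  sstep N mu =i [:: nu].
Proof.
move=> k_gt0 le_k eq_nu.
have -> : nu = fire N mu t.
  by apply/ffunP => p; rewrite ffunE (eqP (etrans (le_k t).2 (eqxx t))) eq_nu.
by apply: (@sstep_maximal mu k t [::]) => // u; rewrite inE.
Qed.

End StrongSleptsovNets.

Lemma zc_fire_mult x mu t : fire_mult (zero_check x) mu t =
  match t with
  | t1 => mu p1
  | t2 => minn (mu p4) (mu p5)
  | t3 => minn (mu p4) (minn (mu p5) (mu p8))
  | t4 => mu p6 %/ 2
  | t5 => minn (mu p5) (mu p6)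
  | t6 => minn (mu p5) (mu p7)
  end.
Proof.
have [q q_in] : exists q, 0 < pre (zero_check x) q t.
  by case: t; [exists p1|exists p4|exists p4|exists p6|exists p5|exists p5].
apply: fire_mult_eq q_in _ => k; apply/idP/forallP => [le_k p|le_k].
  by case: t p le_k => -[] /=; lia.
move: (le_k p1) (le_k p4) (le_k p5) (le_k p6) (le_k p7) (le_k p8).
by case: t {le_k} => /=; lia.
Qed.

(* The marking {c, y.p4, p8}, where [c] lists control tokens with repetition. *)
Definition zc_state (c : seq place) (y : nat) : {ffun place -> nat} :=
  [ffun p => count_mem p c + match p with p4 => y | p8 => 1 | _ => 0 end].

Lemma zc_markingE q y : q != p4 -> q != p8 -> zc_marking q y = zc_state [:: q] y.
Proof. by move=> q4 q8; apply/ffunP; case; rewrite !ffunE; case: q q4 q8. Qed.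

Section ZeroCheckSteps.

Variable x : nat.
Local Notation step := (sstep (zero_check x)).

Local Ltac fires_only t k :=
  apply: (@sstep_unique _ _ _ _ k t) => //;
  [case; apply/leqifP; rewrite zc_fire_mult | case]; rewrite !ffunE /=; lia.

Lemma step_p1 y : step (zc_state [:: p1] y) =i [:: zc_state [:: p5; p5] y].
Proof. fires_only t1 1. Qed.

Lemma step_p5p5_gt1 y :
  step (zc_state [:: p5; p5] y.+2) =i [:: zc_state [:: p6; p6] y].
Proof. fires_only t2 2. Qed.

Lemma step_p6p6 y : step (zc_state [:: p6; p6] y) =i [:: zc_state [:: p2] y.+2].
Proof. fires_only t4 1. Qed.

Lemma step_p5p5_1 : step (zc_state [:: p5; p5] 1) =i
  [:: zc_state [:: p5; p6] 0; zc_state [:: p5; p7] 0].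
Proof.
set mu := zc_state _ 1.
have <- : fire (zero_check x) mu t2 = zc_state [:: p5; p6] 0.
  by apply/ffunP; case; rewrite ffunE zc_fire_mult !ffunE.
have <- : fire (zero_check x) mu t3 = zc_state [:: p5; p7] 0.
  by apply/ffunP; case; rewrite ffunE zc_fire_mult !ffunE.
apply: (@sstep_maximal _ _ _ _ 1 t2 [:: t3]) => // u.
by apply/leqifP; case: u; rewrite zc_fire_mult !ffunE.
Qed.

Lemma step_p5p6 : step (zc_state [:: p5; p6] 0) =i [:: zc_state [:: p3] 1].
Proof. fires_only t5 1. Qed.

Lemma step_p5p7 : step (zc_state [:: p5; p7] 0) =i [:: zc_state [:: p3] 1].
Proof. fires_only t6 1. Qed.

Lemma stuck_p2_p3 q y : q \in [:: p2; p3] -> stuck step (zc_state [:: q] y).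
Proof.
move=> q23; apply/terminalP/forallP => t; rewrite /firable zc_fire_mult.
by move: q23; rewrite !inE => /pred2P[]->; case: t; rewrite !ffunE ?minn0.
Qed.

Lemma inevitable_p2 y :
  inevitable step (zc_state [:: p2] y.+2) (zc_state [:: p1] y.+2).
Proof.
apply: (inevitable_unique (step_p1 _)).
apply: (inevitable_unique (step_p5p5_gt1 _)).
apply: (inevitable_unique (step_p6p6 _)).
exact/InevitableStuck/stuck_p2_p3.
Qed.

Lemma inevitable_p3 : inevitable step (zc_state [:: p3] 1) (zc_state [:: p1] 1).
Proof.
have p3_end : inevitable step (zc_state [:: p3] 1) (zc_state [:: p3] 1).
  exact/InevitableStuck/stuck_p2_p3.
apply: (inevitable_unique (step_p1 _)).
apply: (inevitable_successors step_p5p5_1) => mu; rewrite !inE => /pred2P[]->.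
- exact: inevitable_unique step_p5p6 p3_end.
- exact: inevitable_unique step_p5p7 p3_end.
Qed.

End ZeroCheckSteps.

Lemma zero_check_outcome x : 0 < x ->
  every_run_terminates (zero_check x) /\
  forall s, maximal_run (zero_check x) s ->
    final_marking (zero_check x) s = zc_marking (if 1 < x then p2 else p3) x.
Proof.
move=> x_gt0; apply: inevitable_final_marking.
case: x x_gt0 => [|[|y]] // _; rewrite /= !zc_markingE //.
- exact: inevitable_p3.
- exact: inevitable_p2.
Qed.

Theorem theorem1 :
  (forall x : nat, 1 <= x ->
     every_run_terminates (zero_check x) /\
     forall s : seq {ffun place -> nat}, maximal_run (zero_check x) s ->
       (1 < x -> final_marking (zero_check x) s = zc_marking p2 x) /\
       (x = 1 -> final_marking (zero_check x) s = zc_marking p3 x)) /\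
  (forall v : nat,
     every_run_terminates (zero_check v.+1) /\
     forall s : seq {ffun place -> nat}, maximal_run (zero_check v.+1) s ->
       [/\ final_marking (zero_check v.+1) s p3 = (if v == 0 then 1 else 0),
           final_marking (zero_check v.+1) s p2 = (if 0 < v then 1 else 0)
         & final_marking (zero_check v.+1) s p4 = v.+1]).
Proof.
split=> [x /zero_check_outcome[term fin]|v].
  by split=> // s /fin->; split=> ->.
have [term fin] := zero_check_outcome (ltn0Sn v).
by split=> // s /fin->; case: v {term fin} => [|v]; rewrite !ffunE.
Qed.
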